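(* Let $M=(V,D)$ be a vf-closed $\Delta$-matroid with $|V|>0$. Then $Q_1(M)(-2)=0$.
   Context: A set system is $M=(V,D)$ with $V$ finite, $D$ a family of subsets of $V$; write $Z\in M$ for $Z\in D$; proper means $D\neq\emptyset$. $\oplus$ is symmetric difference. Pivot: $M*X=(V,\{Z\oplus X:Z\in D\})$; loop complementation: $M+w=(V,D\oplus\{Z\cup\{w\}:Z\in D,w\notin Z\})$; operations are applied left to right; dual pivot $M\,\bar{*}\,w=M+w*w+w$; operations on distinct elements commute, and $M\,\bar{*}\,X$ denotes applying $\bar{*}\,w$ for all $w\in X$. For proper $M$, $d_M(X)=\min\{|X\oplus Z|:Z\in M\}$, $d_M=d_M(\emptyset)$, and $Q_1(M)(y)=\sum_{X,Y\subseteq V,\,X\cap Y=\emptyset}y^{d_{M*Y\,\bar{*}\,X}}$. A $\Delta$-matroid is a proper set system such that for all $X,Y\in M$ and $w\in X\oplus Y$, either $X\oplus\{w\}\in M$ or some $v\in X\oplus Y$, $v\neq w$, has $X\oplus\{w,v\}\in M$. $M$ is a vf-closed $\Delta$-matroid if $M\varphi$ is a $\Delta$-matroid for every sequence $\varphi$ of pivots and loop complementations on elements of $V$. *)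

(* Defs.v *)
From HB Require Import structures.
From mathcomp Require Import all_boot all_order all_algebra.

Set Implicit Arguments.
Unset Strict Implicit.
Unset Printing Implicit Defensive.

Import GRing.Theory.

(* The ground set of a set system (V, D) is the whole finite type V, so that
   the set system is just its family D : {set {set V}}. *)

Definition symdiff (T : finType) (A B : {set T}) : {set T} :=
  (A :\: B) :|: (B :\: A).

Section SetSystem.

Variable V : finType.
Implicit Types (D : {set {set V}}) (X Y Z : {set V}) (w v : V).

Definition proper_system D : Prop := D != set0.

Definition pivot D X : {set {set V}} := [set symdiff Z X | Z in D].

Definition loopc D w : {set {set V}} :=
  symdiff D [set w |: Z | Z in D & w \notin Z].

Definition dual_pivot1 D w : {set {set V}} :=
  loopc (pivot (loopc D w) [set w]) w.

(* Dual pivots on distinct elements commute, so the enumeration order of X is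
   irrelevant. *)
Definition dual_pivot D X : {set {set V}} := foldl dual_pivot1 D (enum X).

(* For proper D this is the minimum of #|symdiff X Z| over Z in D: the default
   value #|V| bounds every term. *)
Definition dist D X : nat := \big[minn/#|V|]_(Z in D) #|symdiff X Z|.

Definition Q1 D : {poly int} :=
  (\sum_(X : {set V}) \sum_(Y : {set V} | X :&: Y == set0)
     'X^(dist (dual_pivot (pivot D Y) X) set0))%R.

Definition delta_matroid D : Prop :=
  proper_system D /\
  forall X Y w, X \in D -> Y \in D -> w \in symdiff X Y ->
    symdiff X [set w] \in D \/
    exists v, [/\ v \in symdiff X Y, v != w & symdiff X [set w; v] \in D].

Inductive vf_op : Type :=
  | Pivot of V
  | LoopComplement of V.

Definition apply_op D (o : vf_op) : {set {set V}} :=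
  match o with
  | Pivot w => pivot D [set w]
  | LoopComplement w => loopc D w
  end.

Definition vf_closed_delta_matroid D : Prop :=
  forall phi : seq vf_op, delta_matroid (foldl apply_op D phi).

End SetSystem.

(* Main.v *)
(* Fix w in V.  Grouping the terms of Q1(M) by what happens to w, it suffices
   that for every Delta-matroid N in the orbit of M the three numbers d_N,
   d_{N*w}, d_{N bar* w} are m, m, m+1 in some order: each group then sums to
   y^m (y + 2), which vanishes at y = -2.  With m the minimum of |Z \ w| over
   Z in N, each of the three numbers is m or m+1.  If both d_N and d_{N*w} are
   m, basis exchange moves any Z in N with |Z \ w| = m onto any such Z' lying on
   the other side of w, so N contains Z iff it contains Z + w at level m; these
   cancel in N bar* w, whose number is therefore m+1. *)
Require Import Defs.
From mathcomp Require Import all_boot all_order all_algebra.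
From mathcomp Require Import ring.

Set Implicit Arguments.
Unset Strict Implicit.
Unset Printing Implicit Defensive.

Import GRing.Theory.

(** * Folds of commuting operations *)

Section FoldlCommute.

Variables (T : eqType) (R : Type) (f : R -> T -> R).
Hypothesis fC : forall z x y, f (f z y) x = f (f z x) y.

Lemma foldl_commute z x s : f (foldl f z s) x = foldl f (f z x) s.
Proof. by elim: s z => //= y s IH z; rewrite IH fC. Qed.

Lemma foldl_rem z x s : x \in s -> foldl f z s = foldl f (f z x) (rem x s).
Proof.
elim: s z => //= y s IH z; rewrite inE; have [-> //|yx /= xs] := eqVneq y x.
by rewrite IH // fC.
Qed.

(** Lets any chosen element of [enum X] be treated as the last one in the fold defining
    [dual_pivot]. *)
Lemma foldl_perm z s1 s2 : perm_eq s1 s2 -> foldl f z s1 = foldl f z s2.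
Proof.
elim: s1 s2 z => [|x s1 IH] s2 z eq_s; first by move: eq_s; rewrite perm_sym => /perm_nilP->.
have xs2: x \in s2 by rewrite -(perm_mem eq_s) mem_head.
rewrite (foldl_rem _ xs2) /=; apply: IH.
by rewrite -(perm_cons x) (perm_trans eq_s) // perm_to_rem.
Qed.

End FoldlCommute.

Lemma finset_ind (T : finType) (P : {set T} -> Prop) : P set0 ->
    (forall x (A : {set T}), x \notin A -> P A -> P (x |: A)) ->
  forall A, P A.
Proof.
move=> P0 PU A; have [n] := ubnP #|A|; elim: n A => // n IH A leAn.
have [-> //|[x xA]] := set_0Vmem A; rewrite -(setD1K xA).
by apply: PU; [rewrite setD11 | apply: IH; move: leAn; rewrite (cardsD1 x) xA].
Qed.

(** * Symmetric difference with a singleton *)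

Section SymDiff.

Variable T : finType.
Implicit Types (A B C : {set T}) (w v : T).

Lemma in_symdiff x A B : (x \in symdiff A B) = (x \in A) (+) (x \in B).
Proof. by rewrite /symdiff !inE; case: (x \in A); case: (x \in B). Qed.

Lemma symdiffA A B C : symdiff A (symdiff B C) = symdiff (symdiff A B) C.
Proof. by apply/setP=> x; rewrite !in_symdiff addbA. Qed.

Lemma symdiffC A B : symdiff A B = symdiff B A.
Proof. by apply/setP=> x; rewrite !in_symdiff addbC. Qed.

Lemma symdiffK A B : symdiff (symdiff A B) B = A.
Proof. by apply/setP=> x; rewrite !in_symdiff addbK. Qed.

Lemma symdiff_set0 A : symdiff A set0 = A.
Proof. by apply/setP=> x; rewrite in_symdiff inE addbF. Qed.

Lemma symdiff1_in w A : w \in A -> symdiff A [set w] = A :\ w.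
Proof.
by move=> wA; apply/setP=> x; rewrite in_symdiff !inE; case: eqP => [->|_];
  rewrite ?wA ?addbF.
Qed.

Lemma symdiff1_notin w A : w \notin A -> symdiff A [set w] = w |: A.
Proof.
move=> wA; apply/setP=> x; rewrite in_symdiff !inE.
by case: eqP => [->|_]; rewrite ?(negbTE wA) ?addbF.
Qed.

Lemma symdiff1_setD1 w A : symdiff A [set w] :\ w = A :\ w.
Proof. by apply/setP=> x; rewrite !inE; case: eqP; rewrite ?andbF ?orbF. Qed.

Lemma symdiff_setU1 w v A : w != v -> symdiff (w |: A) [set v] = w |: symdiff A [set v].
Proof.
move=> wv; apply/setP=> x; rewrite in_setU1 !in_symdiff !inE.
by case: (eqVneq x w) => [->|]; rewrite ?(negbTE wv).
Qed.

End SymDiff.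

(** * Algebra of pivots and dual pivots *)

Section SetSystems.

Variable V : finType.
Implicit Types (D : {set {set V}}) (X Y Z A B : {set V}) (w v : V).

Lemma in_pivot D X Z : (Z \in pivot D X) = (symdiff Z X \in D).
Proof.
apply/imsetP/idP => [[A AD ->]|ZD]; first by rewrite symdiffK.
by exists (symdiff Z X); rewrite ?symdiffK.
Qed.

Lemma in_loopc D w Z : (Z \in loopc D w) = (Z \in D) (+) ((w \in Z) && (Z :\ w \in D)).
Proof.
rewrite in_symdiff; congr (_ (+) _); apply/imsetP/andP => [[A]|[wZ ZD]].
  by rewrite inE => /andP[AD wA] ->; rewrite setU11 setU1K.
by exists (Z :\ w); rewrite ?setD1K // inE ZD setD11.
Qed.

(** Over GF(2), record whether [Z] and [w |: Z] belong to [D] as a pair (a, b), for [Z] avoiding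
    [w]. Loop complementation maps it to (a, a+b) and the pivot swaps the entries, so the composite
    gives (a+b, b). *)
Lemma in_dual_pivot1 D w Z :
  (Z \in dual_pivot1 D w) = (Z \in D) (+) ((w \notin Z) && (w |: Z \in D)).
Proof.
rewrite /dual_pivot1 in_loopc !in_pivot !in_loopc !in_symdiff setD11 set11.
case: (boolP (w \in Z)) => wZ /=.
  rewrite symdiff1_in // symdiff1_notin ?setD11 // setD1K //.
  by rewrite addbF addbCA addbb addbF.
by rewrite symdiff1_notin // setU1K // !addbF addbC.
Qed.

Lemma dual_pivot1C D w v :
  dual_pivot1 (dual_pivot1 D v) w = dual_pivot1 (dual_pivot1 D w) v.
Proof.
have [-> //|wv] := eqVneq w v.
apply/setP=> Z; rewrite !in_dual_pivot1 !in_setU1 (negbTE wv) eq_sym (negbTE wv) /=.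
rewrite (setUCA [set w]).
case: (w \in Z); case: (v \in Z) => //=; rewrite ?addbF //.
by rewrite !addbA (addbAC (Z \in D)).
Qed.

Lemma dual_pivot1_pivot D w v : w != v ->
  dual_pivot1 (pivot D [set w]) v = pivot (dual_pivot1 D v) [set w].
Proof.
move=> wv; apply/setP=> Z; rewrite !(in_dual_pivot1, in_pivot).
by rewrite in_symdiff inE (eq_sym v) (negbTE wv) addbF symdiff_setU1 // eq_sym.
Qed.

Lemma dual_pivot_setU1 D w X : w \notin X ->
  dual_pivot D (w |: X) = dual_pivot1 (dual_pivot D X) w.
Proof.
move=> wX; have pX: perm_eq (enum (w |: X)) (w :: enum X).
  apply: uniq_perm; rewrite /= ?enum_uniq ?mem_enum ?wX // => x.
  by rewrite inE !mem_enum !inE.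
by rewrite /dual_pivot (foldl_perm dual_pivot1C _ pX) /= (foldl_commute dual_pivot1C).
Qed.

Lemma dual_pivot0 D : dual_pivot D set0 = D.
Proof. by rewrite /dual_pivot enum_set0. Qed.

(** Brings the operation at [w] to the end, so that the three terms of a group become operations on
    one common system. *)
Lemma dual_pivot_pivot D w X : w \notin X ->
  dual_pivot (pivot D [set w]) X = pivot (dual_pivot D X) [set w].
Proof.
elim/finset_ind: X => [|v X vX IH]; first by rewrite !dual_pivot0.
rewrite in_setU1 negb_or => /andP[wv wX].
by rewrite !dual_pivot_setU1 // IH // dual_pivot1_pivot.
Qed.

Lemma pivot0 D : pivot D set0 = D.
Proof. by apply/setP=> Z; rewrite in_pivot symdiff_set0. Qed.

Lemma pivot_setU1 D w Y : w \notin Y ->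
  pivot D (w |: Y) = pivot (pivot D Y) [set w].
Proof.
by move=> wY; apply/setP=> Z; rewrite !in_pivot -symdiffA (symdiffC [set w])
  symdiff1_notin.
Qed.

Lemma vf_closed_apply_op D o :
  vf_closed_delta_matroid D -> vf_closed_delta_matroid (apply_op D o).
Proof. by move=> hD phi; apply: (hD (o :: phi)). Qed.

Lemma vf_closed_pivot D Y :
  vf_closed_delta_matroid D -> vf_closed_delta_matroid (pivot D Y).
Proof.
move=> hD; elim/finset_ind: Y => [|w Y wY IH]; first by rewrite pivot0.
by rewrite pivot_setU1 //; apply: (vf_closed_apply_op (Pivot w)).
Qed.

Lemma vf_closed_dual_pivot D X :
  vf_closed_delta_matroid D -> vf_closed_delta_matroid (dual_pivot D X).
Proof.
move=> hD; elim/finset_ind: X => [|w X wX IH]; first by rewrite dual_pivot0.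
rewrite dual_pivot_setU1 // /dual_pivot1.
apply: (vf_closed_apply_op (LoopComplement w)).
apply: (vf_closed_apply_op (Pivot w)).
exact: (vf_closed_apply_op (LoopComplement w)).
Qed.

(** * Distances to the empty set and their values at one element *)

Lemma dist0_min D m : (forall Z, Z \in D -> m <= #|Z|) ->
  (exists2 Z, Z \in D & #|Z| = m) ->
  dist D set0 = m.
Proof.
move=> le_m [Z ZD Zm]; rewrite -Zm in le_m *; apply/eqP; rewrite eqn_leq /dist.
have sd A : #|symdiff set0 A| = #|A| by rewrite symdiffC symdiff_set0.
apply/andP; split.
  by rewrite -(sd Z); apply: (Order.TotalTheory.bigmin_le_cond #|V|) ZD.
(* The default [#|V|] is harmless: the minimum is the size of a subset of [V]. *)
elim/big_ind: _ => [|a b le_a le_b|A AD]; first exact: max_card.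
  by rewrite leq_min le_a.
by rewrite sd le_m.
Qed.

(** Induction on the part of [A :\ w] outside [B]. Exchanging an element [u] of that part can only
    bring in some [v] of [B], by minimality of [m]; this keeps the level and the side of [w] while
    moving [A] closer to [B]. *)
Lemma basis_exchange D w m A B : delta_matroid D ->
    (forall Z, Z \in D -> m <= #|Z :\ w|) -> A \in D -> B \in D ->
    #|A :\ w| = m -> #|B :\ w| = m -> w \in symdiff A B ->
  symdiff B [set w] \in D.
Proof.
move=> [_ exch] le_m + BD + mB.
have [n] := ubnP #|(A :\ w) :\: B|; elim: n A => // n IH A ltn AD mA wAB.
have [AB0|[u]] := set_0Vmem ((A :\ w) :\: B).
  suff -> : symdiff B [set w] = A by [].
  (* Inclusion with equal cardinals forces equality, so [A] and [B] differ exactly in [w]. *)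
  have/eqP AB: A :\ w == B :\ w.
    rewrite eqEcard mA mB leqnn andbT subsetD1 setD11 andbT.
    by rewrite -setD_eq0 AB0.
  apply/setP=> x; move: wAB; rewrite !in_symdiff inE.
  have [->|xw] := eqVneq x w; first by case: (w \in A); case: (w \in B).
  by move/setP/(_ x): AB; rewrite !inE xw /= addbF.
rewrite !inE => /and3P[uB uw uA].
have uAw: u \in A :\ w by rewrite !inE uw.
have lt_m Z : #|Z :\ w| < m -> Z \notin D.
  by rewrite ltnNge; apply: contra => /le_m.
have ltA: #|(A :\ u) :\ w| < m.
  by rewrite -mA (cardsD1 u (A :\ w)) uAw setDDl setUC -setDDl.
have uAB: u \in symdiff A B by rewrite in_symdiff uA (negbTE uB).
case: (exch A B u AD BD uAB) => [|[v [vAB vu]]].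
  by rewrite symdiff1_in // (negbTE (lt_m _ ltA)).
have -> : symdiff A [set u; v] = symdiff (A :\ u) [set v].
  by rewrite -symdiff1_in // -symdiffA symdiff1_notin ?inE // setUC.
(* Toggling [w] or removing a second element of [A] would leave fewer than [m] elements off [w];
   hence [v] lies in [B] and outside [A]. *)
have [->|vw] := eqVneq v w.
  by move=> /le_m; rewrite symdiff1_setD1 leqNgt ltA.
case: (boolP (v \in A)) => vA.
  rewrite symdiff1_in ?inE ?vu // => /le_m; rewrite leqNgt (leq_ltn_trans _ ltA) //.
  by rewrite subset_leq_card // setSD // subsetDl.
rewrite symdiff1_notin ?inE ?(negbTE vA) ?andbF // => A'D.
have vB: v \in B by move: vAB; rewrite in_symdiff (negbTE vA).
apply: IH A'D _ _.
- rewrite ltnS in ltn; apply: leq_trans ltn; apply: proper_card; apply/properP; split.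
    by apply/subsetP=> x; rewrite !inE; case: (eqVneq x v) => [->|_]; rewrite ?vB // orFb
      => /and4P[-> -> _ ->].
  by exists u; rewrite !inE ?uB ?uw // eq_sym (negbTE vu) eqxx /= ?andbF.
- have -> : (v |: A :\ u) :\ w = v |: A :\ w :\ u.
    apply/setP=> x; rewrite !inE.
    by case: (eqVneq x v) => [->|_]; rewrite ?vw // orFb andbCA.
  by rewrite cardsU1 !inE (negbTE vA) !andbF -mA (cardsD1 u (A :\ w)) uAw.
- by move: wAB; rewrite !in_symdiff !inE eq_sym (negbTE vw) (eq_sym w) (negbTE uw).
Qed.

Lemma cardsD1_notin w Z : w \notin Z -> #|Z :\ w| = #|Z|.
Proof. by move=> wZ; rewrite [RHS](cardsD1 w) (negbTE wZ). Qed.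

(** A set at level [m] has size [m] if it avoids [w] and [m + 1] otherwise, and no other set is
    smaller than [m + 1]. *)
Lemma dist0_level D w m : (forall Z, Z \in D -> m <= #|Z :\ w|) ->
    (exists2 Z, Z \in D & #|Z :\ w| = m) ->
  dist D set0 = m + ~~ [exists Z in D, (w \notin Z) && (#|Z| == m)].
Proof.
move=> le_m ex_m; apply: dist0_min => [Z ZD|].
  case: exists_inP => [_|noZ]; rewrite /= ?addn0 ?addn1.
    exact: leq_trans (le_m Z ZD) (subset_leq_card (subsetDl _ _)).
  have := le_m Z ZD; have [wZ|wZ] := boolP (w \in Z); first by rewrite (cardsD1 w Z) wZ.
  rewrite cardsD1_notin // leq_eqVlt => /predU1P[eqm|//].
  by case: noZ; exists Z; rewrite // wZ eqm eqxx.
case: exists_inP => [[Z ZD /andP[_ /eqP Zm]]|noZ]; first by exists Z; rewrite ?addn0.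
have [Z ZD Zm] := ex_m; exists Z => //; rewrite /= addn1 (cardsD1 w Z) Zm.
case: (boolP (w \in Z)) => // wZ; case: noZ; exists Z => //.
by rewrite wZ -Zm cardsD1_notin /=.
Qed.

(** The three systems share the level [m]. Their level-[m] sets avoiding [w] form families P, Q and
    the symmetric difference of P and Q. Exchange gives P = Q when both are nonempty, and they are
    not both empty, so exactly two of the three are nonempty. *)
Lemma dist_triple D w : delta_matroid D ->
  exists m,
    [\/ [/\ dist D set0 = m, dist (pivot D [set w]) set0 = m
          & dist (dual_pivot1 D w) set0 = m.+1],
        [/\ dist D set0 = m, dist (pivot D [set w]) set0 = m.+1
          & dist (dual_pivot1 D w) set0 = m]
      | [/\ dist D set0 = m.+1, dist (pivot D [set w]) set0 = m
          & dist (dual_pivot1 D w) set0 = m]].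
Proof.
move=> dmD; have [/set0Pn[Z0 Z0D] _] := dmD.
have [Z1 Z1D le_m]: exists2 Z1, Z1 \in D & forall Z, Z \in D -> #|Z1 :\ w| <= #|Z :\ w|.
  by case: (arg_minnP (fun Z : {set V} => #|Z :\ w|) Z0D) => Z1; exists Z1.
set m := #|Z1 :\ w| in le_m *; exists m.
have le_mp Z : Z \in pivot D [set w] -> m <= #|Z :\ w|.
  by rewrite in_pivot => /le_m; rewrite symdiff1_setD1.
have le_md Z : Z \in dual_pivot1 D w -> m <= #|Z :\ w|.
  rewrite in_dual_pivot1; case: (boolP (Z \in D)) => [/le_m //|_ /andP[wZ /le_m]].
  by rewrite -(symdiff1_notin wZ) symdiff1_setD1.
rewrite (dist0_level le_m); last by exists Z1.
rewrite (dist0_level le_mp); last first.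
  by exists (symdiff Z1 [set w]); rewrite ?in_pivot ?symdiffK ?symdiff1_setD1.
rewrite (dist0_level le_md); last first.
  (* If [Z1] is cancelled, then [w |: Z1] is in [D], and it survives because it contains [w]. *)
  have [Z1d|] := boolP (Z1 \in dual_pivot1 D w); first by exists Z1.
  rewrite in_dual_pivot1 Z1D /= negbK => /andP[wZ1 wZ1D].
  exists (w |: Z1); first by rewrite in_dual_pivot1 setU11 wZ1D.
  by rewrite -(symdiff1_notin wZ1) symdiff1_setD1.
have lvlU (Z : {set V}) : w \notin Z -> #|(w |: Z) :\ w| = #|Z| by move=> wZ; rewrite setU1K.
case: exists_inP => [[A AD /andP[wA /eqP Am]]|no0];
  case: exists_inP => [[B]|no1]; rewrite ?addn0 ?addn1 /=.
- rewrite in_pivot => BD /andP[wB /eqP Bm].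
  rewrite symdiff1_notin // in BD.
  case: exists_inP => [[C]|_]; last by rewrite addn1; apply: Or31.
  rewrite in_dual_pivot1 => + /andP[wC /eqP Cm]; rewrite wC /=.
  (* Exactly one of [C] and [w |: C] is in [D]; exchange with the witness on the other side of [w]
     ([w |: B] or [A]) puts the other one in [D] too. *)
  have [CD|CD] := boolP (C \in D) => /= CD'.
    case/negP: CD'; rewrite -symdiff1_notin //.
    by apply: (basis_exchange dmD le_m BD CD); rewrite ?lvlU ?cardsD1_notin // in_symdiff setU11.
  case/negP: CD; rewrite -(symdiffK C [set w]) (symdiff1_notin wC).
  by apply: (basis_exchange dmD le_m AD CD'); rewrite ?lvlU ?cardsD1_notin // in_symdiff setU11 addbT.
- case: exists_inP => [_|[]]; first by rewrite addn0; apply: Or32.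
  (* [A] is not cancelled: [w |: A] in [D] would put [A] in the pivot at level [m]. *)
  exists A; rewrite ?wA ?Am ?eqxx // in_dual_pivot1 AD wA /=.
  apply: contra_notN no1 => wAD; exists A; rewrite ?wA ?Am ?eqxx //.
  by rewrite in_pivot symdiff1_notin.
- rewrite in_pivot => BD /andP[wB /eqP Bm]; rewrite symdiff1_notin // in BD.
  case: exists_inP => [_|[]]; first by rewrite addn0; apply: Or33.
  exists B; rewrite ?wB ?Bm ?eqxx // in_dual_pivot1 BD wB andbT addbT.
  by apply: contra_notN no0 => BD'; exists B; rewrite ?wB ?Bm ?eqxx.
(* The minimiser [Z1] lies on one side of [w], so both families cannot be empty. *)
have [wZ1|wZ1] := boolP (w \in Z1).
  case: no1; exists (Z1 :\ w); rewrite ?setD11 ?eqxx //.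
  by rewrite in_pivot symdiff1_notin ?setD11 // setD1K.
by case: no0; exists Z1; rewrite // wZ1 /m cardsD1_notin ?eqxx.
Qed.

(** * Grouping the sum by the position of one element *)

Lemma setU1K_eq w X : ((w |: X) :\ w == X) = (w \notin X).
Proof.
by apply/eqP/idP => [<-|/setU1K //]; rewrite setD11.
Qed.

Lemma disjoint_setU1 w X Y : (X :&: (w |: Y) == set0) = (w \notin X) && (X :&: Y == set0).
Proof. by rewrite setIUr setU_eq0 setI_eq0 disjoint_sym disjoints1. Qed.

(** Disjointness leaves three places for [w]: in neither set, in [Y], or in [X]. Deleting [w]
    reindexes each class by the pairs avoiding it. *)
Lemma sum_disjoint_pairs (R : nmodType) w (F : {set V} -> {set V} -> R) :
  (\sum_X \sum_(Y | X :&: Y == set0) F X Y =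
   \sum_(p : {set V} * {set V} | (p.1 :&: p.2 == set0) && (w \notin p.1 :|: p.2))
     (F p.1 p.2 + F p.1 (w |: p.2) + F (w |: p.1) p.2))%R.
Proof.
rewrite pair_big_dep /= (bigID (fun p => w \in p.1 :|: p.2)) /= addrC.
rewrite !big_split /= -addrA; congr (_ + _)%R.
rewrite (bigID (fun p : {set V} * {set V} => w \in p.2)) /=; congr (_ + _)%R.
  rewrite (reindex_onto (fun p : {set V} * {set V} => (p.1, w |: p.2))
                        (fun p => (p.1, p.2 :\ w))) /=; last first.
    by case=> X Y /= /andP[_ wY]; rewrite setD1K.
  apply: eq_bigl => -[X Y] /=.
  rewrite xpair_eqE eqxx setU1K_eq disjoint_setU1 !inE eqxx orbT !andbT negb_or.
  by case: (w \in X); rewrite ?andbF.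
rewrite (reindex_onto (fun p : {set V} * {set V} => (w |: p.1, p.2))
                      (fun p => (p.1 :\ w, p.2))) /=; last first.
  by case=> X Y /= /andP[/andP[_]]; rewrite inE => /orP[wX _|->//]; rewrite setD1K.
apply: eq_bigl => -[X Y] /=.
rewrite xpair_eqE eqxx setU1K_eq setIC disjoint_setU1 setIC !inE eqxx !andbT negb_or.
by case: (w \in X); case: (w \in Y); rewrite ?andbF ?andbT.
Qed.

End SetSystems.

Theorem theorem26 (V : finType) (D : {set {set V}})
    (hD : vf_closed_delta_matroid D) (hV : (0 < #|V|)%N) :
  ((Q1 D).[-2] = 0)%R.
Proof.
have /card_gt0P[w _] := hV.
rewrite /Q1 (sum_disjoint_pairs w) horner_sum big1 // => -[X Y] /= /andP[_].
rewrite inE negb_or => /andP[wX wY].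
rewrite (pivot_setU1 _ wY) (dual_pivot_pivot _ wX) (dual_pivot_setU1 _ wX).
set N := dual_pivot _ _.
have dmN: delta_matroid N.
  (* The empty sequence of operations extracts the exchange property of [N] itself. *)
  exact: (vf_closed_dual_pivot X (vf_closed_pivot Y hD) [::]).
have [m] := dist_triple w dmN.
(* In each order the group is 2(-2)^m + (-2)^(m+1) = 0. *)
by case=> -[-> -> ->]; rewrite !hornerD !hornerXn exprS; ring.
Qed.
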